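(* Let $k\ge2$, $t\ge2$ be integers and let $c,c_1,c_2>0$ be real numbers. Let $\lambda$, $\lambda_1$ and $\lambda_2$ be the second largest eigenvalues of $T(k,t,c)$, $T(k,t+1,c_1)$ and $T(k,t,c_2)$, respectively. Suppose there exists a connected $k$-regular graph with second largest eigenvalue at most $\lambda$ and with exactly $M(k,t,c)$ vertices (equivalently, $v(k,\lambda)=M(k,t,c)$). Then: (1) If $c=1$, then $v(k,\lambda_1)=v(k,\lambda)$ whenever $c_1>k(k-1)^{t-1}$. Moreover, if $c=1$, $M(k,t,c)$ is even and $k$ is odd, then $v(k,\lambda_1)=v(k,\lambda)$ whenever $c_1>k(k-1)^{t-1}/2$. (2) If $c>1$, then $v(k,\lambda_2)=v(k,\lambda)$ whenever $c\ge c_2>c-\dfrac{c^2}{k(k-1)^{t-2}+c}$. Moreover, if $c>1$, $M(k,t,c)$ is even and $k$ is odd, then $v(k,\lambda_2)=v(k,\lambda)$ whenever $c\ge c_2>c-\dfrac{2c^2}{k(k-1)^{t-2}+2c}$.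
   Context: Graphs are finite and simple. The second largest eigenvalue of a connected $k$-regular graph $G$ is the second largest eigenvalue $\lambda_2(G)<k$ of its adjacency matrix. For real $x$, $v(k,x)$ denotes the maximum number of vertices of a connected $k$-regular graph $G$ with $\lambda_2(G)\le x$. For an integer $s\ge2$ and real $b>0$, $T(k,s,b)$ is the $s\times s$ tridiagonal matrix with lower diagonal $(1,1,\dots,1,b)$, upper diagonal $(k,k-1,\dots,k-1)$, and diagonal entries chosen so that every row sum equals $k$ (for $s=2$ the lower diagonal is $(b)$ and the upper diagonal is $(k)$). Its eigenvalues are real and simple, the largest being $k$. Also $$M(k,s,b)=1+\sum_{i=0}^{s-3}k(k-1)^i+\frac{k(k-1)^{s-2}}{b},$$ where empty sums are $0$. It is a fact that $v(k,x)\le M(k,s,b)$ when $x$ is the second largest eigenvalue of $T(k,s,b)$. *)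

(* Defs.v *)
From mathcomp Require Import all_boot all_order all_algebra.
From mathcomp Require Import reals.
From mathcomp Require Import polyrcf.

Set Implicit Arguments.
Unset Strict Implicit.
Unset Printing Implicit Defensive.

Import Order.TTheory GRing.Theory Num.Theory.
Local Open Scope ring_scope.

Record sgraph := SGraph {
  vertex : finType;
  adj : rel vertex;
  adj_sym : symmetric adj;
  adj_irrefl : irreflexive adj
}.

Definition order_of (G : sgraph) : nat := #|vertex G|.

(* The graph with no vertices is not considered connected. *)
Definition connected (G : sgraph) : Prop :=
  (0 < order_of G)%N /\ forall x y : vertex G, connect (@adj G) x y.

Definition regular (k : nat) (G : sgraph) : Prop :=
  forall x : vertex G, #|[set y | adj x y]| = k.

Definition adjacency (R : realType) (G : sgraph) : 'M[R]_(order_of G) :=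
  \matrix_(i, j) (adj (enum_val i) (enum_val j))%:R.

(* The real eigenvalues of A, each repeated according to its algebraic
   multiplicity, in nonincreasing order. *)
Definition spectrum (R : realType) (n : nat) (A : 'M[R]_n) : seq R :=
  sort >=%R
    (flatten [seq nseq (mup a (char_poly A)) a | a <- rootsR (char_poly A)]).

(* This is 0 by convention when A has fewer than two real eigenvalues. *)
Definition second_eigenvalue (R : realType) (n : nat) (A : 'M[R]_n) : R :=
  (spectrum A)`_1.

Definition admissible (R : realType) (k : nat) (x : R) (G : sgraph) : Prop :=
  [/\ connected G, regular k G & second_eigenvalue (adjacency R G) <= x].

(* v(k, x) = n: the maximum exists and equals n. *)
Definition v_is (R : realType) (k : nat) (x : R) (n : nat) : Prop :=
  (exists2 G : sgraph, admissible k x G & order_of G = n) /\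
  (forall G : sgraph, admissible k x G -> (order_of G <= n)%N).

(* v(k, x) = v(k, y), both maxima existing. *)
Definition v_eq (R : realType) (k : nat) (x y : R) : Prop :=
  exists2 n : nat, v_is k x n & v_is k y n.

(* Rows and columns are numbered from 0, so the last row has index s - 1. *)
Definition T_offdiag (R : realType) (k s : nat) (b : R) : 'M[R]_s :=
  \matrix_(i, j)
    if i == j.+1 :> nat then (if i.+1 == s then b else 1)
    else if j == i.+1 :> nat then (if i == 0 :> nat then k%:R else k%:R - 1)
    else 0.

Definition T (R : realType) (k s : nat) (b : R) : 'M[R]_s :=
  T_offdiag k s b + diag_mx (\row_i (k%:R - \sum_j T_offdiag k s b i j)).

Definition M (R : realType) (k s : nat) (b : R) : R :=
  1 + \sum_(i < s - 2) k%:R * (k%:R - 1) ^+ i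
    + k%:R * (k%:R - 1) ^+ (s - 2) / b.

(* Main.v *)
Require Import Defs.
From mathcomp Require Import all_boot all_order all_algebra.
From mathcomp Require Import reals polyrcf complex.
From mathcomp Require Import ring lra zify.

(** Everything rests on the bound v(k, lambda) <= M(k, s, b), where lambda is the
second eigenvalue of T(k, s, b), and on two monotonicity facts.

The matrix T(k, s, b) is reversible for the masses 1, k, k(k-1), ...,
k(k-1)^(s-2)/b, which are the sizes of the spheres in the k-regular tree except
that the last one is divided by b; their sum is M(k, s, b).  For a reversible
matrix with row sums kappa, kappa minus the second eigenvalue is the least ratio
of Dirichlet energy to variance ([spectral_gap], [second_eigenvector]).  The
energy of T(k, s, b) is a sum of the terms k(k-1)^i (x_i - x_(i+1))^2, in which b
does not occur, so enlarging masses increases the variance only and raises the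
second eigenvalue: it is nonincreasing in b ([second_eigenvalue_T_last]), and
extending an eigenvector by its last value compares T(k, t, 1) with
T(k, t+1, c1) ([second_eigenvalue_T_extend]).

For the bound, let phi be an eigenvector of T(k, s, b) for lambda.  Replacing the
differences phi_i - phi_(i+1) by their absolute values keeps the energy and can
only increase the variance, so minimality forces all of them to have one sign,
and phi may be taken nonincreasing with last value a < 0
([T_decreasing_eigenvector]).  Given a k-regular graph of order v with second
eigenvalue at most lambda and a vertex u, put
w = sum_(i <= s-2) (phi_i - a) N_i, where N_i(x) is the number of non-backtracking
walks of length i from u to x.  The three-term recurrence for the N_i imitates
the rows of T, so that A w - lambda w dominates (k - lambda)(-a) sum_i N_i, and
then w (A w - lambda w) >= (k - lambda)(-a) w at each vertex
([radial_superharmonic]), the N_i being natural numbers.  The sum of w is W = -a M,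
because phi has weighted mean zero.  Comparing with the variational bound
<w, A w - lambda w> <= (k - lambda) W^2 / v yields v <= M ([order_le_M]).

Finally, under the hypotheses on c1 and c2 the new value of M exceeds the old one,
which is the order of the given graph, by less than 1; or by less than 2 when k
is odd, in which case all orders are even by the handshake lemma. *)

Set Implicit Arguments.
Unset Strict Implicit.
Unset Printing Implicit Defensive.

Import Order.TTheory GRing.Theory Num.Theory.
Local Open Scope ring_scope.

(** * Spectra of real symmetric matrices *)

Lemma char_poly_intertwine (F : fieldType) (n : nat) (A B P : 'M[F]_n) :
  P \in unitmx -> B *m P = P *m A -> char_poly B = char_poly A.
Proof.
move=> uP BP_PA; pose Pp := map_mx polyC P.
have detP : \det Pp != 0.
  by rewrite det_map_mx polyC_eq0 -unitfE -unitmxE.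
apply: (mulIf detP); rewrite [RHS]mulrC /char_poly -!det_mulmx.
rewrite /char_poly_mx mulmxBl mulmxBr -!map_mxM BP_PA.
by rewrite scalar_mxC.
Qed.

(** When the characteristic polynomial splits, listing the roots in nonincreasing
order amounts to sorting the indices; working with indices rather than with
values gives access to two different eigenvectors for a repeated eigenvalue. *)
Lemma spectrum_prod (R : realType) (n : nat) (A : 'M[R]_n) (r : 'I_n -> R) :
  char_poly A = \prod_i ('X - (r i)%:P) ->
  exists e : seq 'I_n,
    [/\ perm_eq e (enum 'I_n), sorted (fun i j => r j <= r i) e
      & spectrum A = map r e].
Proof.
move=> chA; pose le := fun i j => r j <= r i.
exists (sort le (enum 'I_n)).
have tot_le : total le by move=> i j; apply: le_total.
split; [by rewrite perm_sort | exact: (sort_sorted tot_le) | ].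
rewrite /spectrum.
have -> : map r (sort le (enum 'I_n)) = sort >=%R (map r (enum 'I_n)).
  exact: (esym (@sort_map _ _ r >=%R _)).
apply/perm_sortP.
- by move=> x y; apply: le_total.
- by move=> y x z xy yz; apply: le_trans yz xy.
- by move=> x y /andP[xy yx]; apply/le_anti/andP.
have chA' : char_poly A = \prod_(x <- map r (enum 'I_n)) ('X - x%:P).
  by rewrite chA big_map big_enum.
have chA_neq0 : char_poly A != 0 by rewrite monic_neq0 ?char_poly_monic.
have uniq_rts : uniq (rootsR (char_poly A)).
  exact: uniq_roots.
apply/allP => a _ /=; apply/eqP.
rewrite -[RHS]mu_prod_XsubC -chA' count_flatten sumnE !big_map.
under eq_bigr => y _ do rewrite count_nseq /=.
have mem_rts y : (y \in rootsR (char_poly A)) = root (char_poly A) y.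
  by have := roots_on_rootsR chA_neq0 y; rewrite in_itv /= => <-.
case: (boolP (a \in rootsR (char_poly A))) => [ain|anin].
  rewrite (bigD1_seq a) //= eqxx mul1n big1 ?addn0 // => y /negPf ya.
  by rewrite ya mul0n.
rewrite big_seq big1; last first.
  move=> y yin; case: eqP => [ya|_]; last by rewrite mul0n.
  by rewrite -ya yin in anin.
by rewrite mupNroot // -mem_rts.
Qed.

Local Open Scope sesquilinear_scope.
Local Notation RtoC := (real_complex _).

(** The unitary diagonalization lives over the complex numbers, but its diagonal is
real, so the characteristic polynomial splits over the reals. *)
Lemma symmetric_spectral (R : realType) (n : nat) (S : 'M[R]_n) :
  S^T = S ->
  exists (P : 'M[R[i]]_n) (r : 'I_n -> R),
    [/\ P \is unitarymx,
        P *m map_mx RtoC S = diag_mx (\row_i RtoC (r i)) *m P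
      & char_poly S = \prod_i ('X - (r i)%:P)].
Proof.
move=> symS; pose A := map_mx RtoC S.
have hermA : A \is hermsymmx.
  apply: realsym_hermsym.
    by apply/is_hermitianmxP; rewrite expr0 scale1r; apply/matrixP => i j;
      rewrite !mxE -{1}symS mxE.
  apply/mxOverP => i j; rewrite mxE; apply/Creal_ImP.
  by rewrite -complexIm.
have [P [d [Punit A_eq realD]]] : exists (P : 'M[R[i]]_n) (d : 'rV[R[i]]_n),
    [/\ P \is unitarymx, A = invmx P *m diag_mx d *m P & d \is a realmx].
  exists (spectralmx A), (spectral_diag A); split.
  - exact: spectral_unitarymx.
  - exact/orthomx_spectralP/hermitian_normalmx.
  - exact: hermitian_spectral_diag_real.
have uP : P \in unitmx := unitarymx_unit Punit.
pose r i := complex.Re (d 0 i).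
have dE : d = \row_i RtoC (r i).
  by apply/rowP => i; rewrite mxE /r RRe_real //; apply/mxOverP.
have PA : P *m A = diag_mx (\row_i RtoC (r i)) *m P.
  by rewrite -dE [in LHS]A_eq -mulmxA (mulKVmx uP).
exists P, r; split=> //.
apply: (@map_poly_inj _ _ (real_complex R)).
rewrite map_char_poly -/A -(char_poly_intertwine uP (esym PA)).
rewrite char_poly_trig ?diag_mx_is_trig // rmorph_prod /=.
apply: eq_bigr => i _.
by rewrite rmorphB /= map_polyX map_polyC /= !mxE eqxx mulr1n.
Qed.

Lemma unitary_coordinates (R : realType) (n : nat) (P : 'M[R[i]]_n)
    (x z : 'rV[R]_n) :
  P \is unitarymx ->
  let y := map_mx RtoC x *m P^t* in let w := map_mx RtoC z *m P^t* in
  map_mx RtoC x = y *m P /\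
  RtoC ((x *m z^T) 0 0) = \sum_i y 0 i * (w 0 i)^*.
Proof.
move=> Punit y w.
have xE (v : 'rV[R]_n) : map_mx RtoC v = map_mx RtoC v *m P^t* *m P.
  by rewrite -mulmxA -invmx_unitary // mulVmx ?mulmx1 // unitarymx_unit.
split; first exact: xE.
have zC : map_mx RtoC z^T = (map_mx RtoC z)^t*.
  apply/matrixP => i j; rewrite !mxE; apply/esym/CrealP/Creal_ImP.
  by rewrite -complexIm.
have -> : RtoC ((x *m z^T) 0 0) = map_mx RtoC (x *m z^T) 0 0 by rewrite [RHS]mxE.
rewrite map_mxM zC (xE x) (xE z) -/y -/w trmx_mul map_mxM mulmxA.
rewrite mulmxtVK // mxE; apply: eq_bigr => i _.
by rewrite !mxE.
Qed.

(** Here [u] is an eigenvector for the largest eigenvalue [kappa] of [S]. *)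
Section SymmetricSecondEigenvalue.

Variables (R : realType) (n : nat) (S : 'M[R]_n) (u : 'rV[R]_n) (kappa : R).
Hypotheses (symS : S^T = S) (u_neq0 : u != 0) (uS : u *m S = kappa *: u).
Hypothesis kappa_top :
  forall x : 'rV_n, (x *m S *m x^T) 0 0 <= kappa * (x *m x^T) 0 0.
Hypothesis n_gt1 : (1 < n)%N.

Lemma norm_row_gt0 (x : 'rV[R]_n) : x != 0 -> 0 < (x *m x^T) 0 0.
Proof.
move=> /rV0Pn[i xi]; rewrite mxE (bigD1 i) //= mxE.
apply: ltr_wpDr; last by rewrite -expr2 exprn_even_gt0.
by apply: sumr_ge0 => j _; rewrite mxE -expr2 sqr_ge0.
Qed.

(** The indices [i0] and [i1] are the first two in the sorted list of eigenvalues;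
[kappa] is an eigenvalue that no other exceeds, hence the first one. *)
Lemma spectral_top_two :
  exists (P : 'M[R[i]]_n) (r : 'I_n -> R) (i0 i1 : 'I_n),
    [/\ P \is unitarymx,
        P *m map_mx RtoC S = diag_mx (\row_i RtoC (r i)) *m P,
        char_poly S = \prod_i ('X - (r i)%:P)
      & [/\ i0 != i1, r i0 = kappa, r i1 = second_eigenvalue S,
        r i1 <= kappa & forall i, i != i0 -> r i <= r i1]].
Proof.
have [P [r [Punit PS chS]]] := symmetric_spectral symS.
have [e [perm_e sorted_e specE]] := spectrum_prod chS.
have size_e : size e = n by rewrite (perm_size perm_e) size_enum_ord.
have uniq_e : uniq e by rewrite (perm_uniq perm_e) enum_uniq.
case: e perm_e sorted_e specE size_e uniq_e => [|i0 [|i1 e]] perm_e.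
- by move=> _ _ /= size0; suff : (1 < 0)%N by []; rewrite [X in (_ < X)%N]size0.
- by move=> _ _ /= size1; suff : (1 < 1)%N by []; rewrite [X in (_ < X)%N]size1.
move=> /= /andP[r10 path_e] specE _ /andP[i0_notin _].
have mem_e i : i \in [:: i0, i1 & e] by rewrite (perm_mem perm_e) mem_enum.
have r_le_r1 i : i != i0 -> r i <= r i1.
  move=> /negPf i_i0; have := mem_e i; rewrite !inE i_i0 /=.
  case/orP => [/eqP->//|ie].
  have tr : transitive (fun i j => r j <= r i).
    by move=> y x z xy yz; apply: le_trans xy.
  by have /allP/(_ i ie) := order_path_min tr path_e.
have r_le_r0 i : r i <= r i0.
  by have [->//|/r_le_r1 ri] := eqVneq i i0; apply: le_trans ri r10.
have root_r a : root (char_poly S) a = (a \in map r (enum 'I_n)).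
  have -> : char_poly S = \prod_(x <- map r (enum 'I_n)) ('X - x%:P).
    by rewrite chS big_map big_enum.
  exact: root_prod_XsubC.
have r_le_kappa i : r i <= kappa.
  have : eigenvalue S (r i).
    by rewrite eigenvalue_root_char root_r map_f ?mem_enum.
  case/eigenvalueP => x xS x_neq0.
  have := kappa_top x; rewrite xS -scalemxAl mxE.
  by rewrite ler_pM2r // norm_row_gt0.
have : kappa \in map r (enum 'I_n).
  by rewrite -root_r -eigenvalue_root_char; apply/eigenvalueP; exists u.
case/mapP => j _ kappaE.
exists P, r, i0, i1; split=> //; split=> //.
- by apply: contraNneq i0_notin => ->; rewrite mem_head.
- by apply/le_anti; rewrite r_le_kappa kappaE r_le_r0.
- by rewrite /second_eigenvalue specE.
Qed.

Let lambda := second_eigenvalue S.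

(** If the second eigenvalue is [kappa], this is the maximality of [kappa].
Otherwise [kappa] is simple, [u] spans its eigenspace, and a vector orthogonal to
[u] has no component along the top eigenvector. *)
Lemma symmetric_rayleigh (x : 'rV[R]_n) :
  (x *m u^T) 0 0 = 0 -> (x *m S *m x^T) 0 0 <= lambda * (x *m x^T) 0 0.
Proof.
move=> xu0; have [P [r [i0 [i1 [Punit PS _ [_ r0 r1 r1_le r_le]]]]]] := spectral_top_two.
have [kappa_le|lt_kappa] := leP kappa lambda.
  have -> : lambda = kappa by apply/le_anti; rewrite kappa_le /lambda -r1 r1_le.
  exact: kappa_top.
set y := map_mx RtoC x *m P^t*; set w := map_mx RtoC u *m P^t*.
have [xP xx] := unitary_coordinates x x Punit.
have [_ xu] := unitary_coordinates x u Punit.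
have [uP _] := unitary_coordinates u u Punit.
rewrite -/y -/w in xP xx uP xu.
have PtS : map_mx RtoC S *m P^t* = P^t* *m diag_mx (\row_i RtoC (r i)).
  have PtP : P^t* *m P = 1%:M.
    by rewrite -invmx_unitary // mulVmx // unitarymx_unit.
  have /(congr1 (fun X => P^t* *m X *m P^t*)) := PS.
  by rewrite /= !mulmxA PtP mul1mx mulmxtVK.
have coordS (z : 'rV[R]_n) i :
    (map_mx RtoC (z *m S) *m P^t*) 0 i = (map_mx RtoC z *m P^t*) 0 i * RtoC (r i).
  by rewrite map_mxM -mulmxA PtS mulmxA mul_mx_diag !mxE.
have w0 i : i != i0 -> w 0 i = 0.
  move=> /r_le ri; have := coordS u i; rewrite uS map_mxZ -scalemxAl mxE -/w.
  move/eqP; rewrite mulrC -subr_eq0 -mulrBr mulf_eq0 => /orP[/eqP//|].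
  rewrite -rmorphB fmorph_eq0 subr_eq0 => /eqP kr; exfalso.
  by move: lt_kappa; rewrite kr ltNge /lambda -r1 ri.
have wi0 : w 0 i0 != 0.
  apply: contraNneq u_neq0 => wi0.
  have w_eq0 : w = 0.
    by apply/rowP => i; rewrite [RHS]mxE; have [->//|/w0] := eqVneq i i0.
  by move: uP; rewrite w_eq0 mul0mx => /eqP; rewrite map_mx_eq0.
have y0 : y 0 i0 = 0.
  move: xu; rewrite xu0 rmorph0 (bigD1 i0) //= big1 => [|i /w0->]; last first.
    by rewrite conjC0 mulr0.
  by rewrite addr0 => /esym/eqP; rewrite mulf_eq0 conjC_eq0 (negPf wi0) orbF => /eqP.
have [_ xSx] := unitary_coordinates (x *m S) x Punit.
have RtoC_M a b : RtoC (a * b) = RtoC a * RtoC b :> R[i] by rewrite rmorphM.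
rewrite -lecR RtoC_M xSx xx mulr_sumr; apply: ler_sum => i _.
rewrite coordS -/y mulrAC [leLHS]mulrC -normCK.
have [->|/r_le ri] := eqVneq i i0; first by rewrite y0 normr0 expr0n /= !mulr0.
by apply: ler_wpM2r; rewrite ?exprn_ge0 // lecR /lambda -r1.
Qed.

(** Orthogonality to [u] is automatic unless the second eigenvalue is [kappa]
itself; then the eigenspace of [kappa] has dimension at least two and meets the
orthogonal of [u]. *)
Lemma symmetric_second_eigenvector :
  exists x : 'rV[R]_n,
    [/\ x != 0, (x *m u^T) 0 0 = 0 & x *m S = lambda *: x].
Proof.
have [P [r [i0 [i1 [Punit PS chS [i01 r0 r1 r1_le r_le]]]]]] := spectral_top_two.
have [kappa_le|lt_kappa] := leP kappa lambda; last first.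
  have : eigenvalue S lambda.
    rewrite eigenvalue_root_char /root chS horner_prod; apply/prodf_eq0.
    by exists i1 => //; rewrite hornerXsubC /lambda r1 subrr.
  case/eigenvalueP => x xS x_neq0; exists x; split=> //.
  have : lambda * (x *m u^T) 0 0 = kappa * (x *m u^T) 0 0.
    transitivity ((x *m S *m u^T) 0 0); first by rewrite xS -scalemxAl [RHS]mxE.
    rewrite -mulmxA -{1}symS -trmx_mul uS linearZ /= -scalemxAr.
    by rewrite [LHS]mxE.
  move/eqP; rewrite -subr_eq0 -mulrBl mulf_eq0 subr_eq0 => /orP[|/eqP//].
  by rewrite (lt_eqF lt_kappa).
have lambdaE : lambda = kappa by apply/le_anti; rewrite kappa_le /lambda -r1 r1_le.
(* Two orthonormal eigenvectors share the eigenvalue: a nonzero combination v of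
   them is orthogonal to u, and its real or its imaginary part is nonzero. *)
have [w wE] : exists w, w = map_mx RtoC u *m P^t* by exists (map_mx RtoC u *m P^t*).
pose v : 'rV[R[i]]_n := if w 0 i0 == 0 then delta_mx 0 i0
  else (w 0 i1)^* *: delta_mx 0 i0 - (w 0 i0)^* *: delta_mx 0 i1.
have v_neq0 : v != 0.
  apply/rV0Pn; rewrite /v; case: eqP => [_|/eqP wi0].
    by exists i0; rewrite mxE !eqxx oner_eq0.
  exists i1; rewrite !mxE !eqxx (eq_sym i1) (negPf i01) /=.
  by rewrite mulr0 sub0r mulr1 oppr_eq0 conjC_eq0.
have vD : v *m diag_mx (\row_i RtoC (r i)) = RtoC lambda *: v.
  apply/rowP => i; rewrite mul_mx_diag !mxE mulrC.
  have [->|ii0] := eqVneq i i0; first by rewrite r0 lambdaE.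
  have [->|ii1] := eqVneq i i1; first by rewrite r1.
  by rewrite /v; case: ifP => _;
    rewrite !mxE (negPf ii0) ?(negPf ii1) /= ?andbF !(mulr0, subr0).
have vu : v *m P *m map_mx RtoC u^T = 0.
  have uC : map_mx RtoC u^T = (map_mx RtoC u)^t*.
    apply/matrixP => i j; rewrite !mxE; apply/esym/CrealP/Creal_ImP.
    by rewrite -complexIm.
  have Pu : P *m (map_mx RtoC u)^t* = w^t*.
    by rewrite wE trmx_mul map_mxM trmxCK.
  rewrite -mulmxA uC Pu /v; case: eqP => [wi0|_].
    by apply/matrixP => a b; rewrite !ord1 -rowE !mxE wi0 conjC0.
  rewrite mulmxBl -!scalemxAl -!rowE; apply/matrixP => a b.
  by rewrite !ord1 !mxE mulrC subrr.
have [x [x_neq0 xu xS]] : exists x : 'rV[R[i]]_n,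
    [/\ x != 0, x *m map_mx RtoC u^T = 0
      & x *m map_mx RtoC S = RtoC lambda *: x].
  exists (v *m P); split=> //; last by rewrite -mulmxA PS mulmxA vD scalemxAl.
  apply: contraNneq v_neq0 => x0.
  by rewrite -(mulmxK (unitarymx_unit Punit) v) x0 mul0mx.
have part (f : R[i] -> R) :
    f 0 = 0 -> {morph f : a b / a + b} ->
    (forall z a, f (z * RtoC a) = f z * a) -> map_mx f x != 0 ->
    exists y : 'rV[R]_n,
      [/\ y != 0, (y *m u^T) 0 0 = 0 & y *m S = lambda *: y].
  move=> f0 fD fM fx; exists (map_mx f x); split=> //.
    have /(congr1 (fun B : 'M_1 => f (B 0 0))) := xu.
    rewrite !mxE f0 (big_morph f fD f0) => sum0; rewrite -[RHS]sum0.
    by apply: eq_bigr => i _; rewrite !mxE fM.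
  apply/rowP => j; have /(congr1 (fun B : 'rV_n => f (B 0 j))) := xS.
  rewrite !mxE (big_morph f fD f0) mulrC fM mulrC => <-.
  by apply: eq_bigr => i _; rewrite !mxE fM.
have [Re0|] := eqVneq (map_mx (@complex.Re R) x) 0; last first.
  by apply: part => [|[a b] [c d]|[a b] c] //=; rewrite mulr0 subr0.
have [Im0|] := eqVneq (map_mx (@complex.Im R) x) 0; last first.
  by apply: part => [|[a b] [c d]|[a b] c] //=; rewrite mulr0 add0r.
case/eqP: x_neq0; apply/rowP => i; rewrite [RHS]mxE [LHS]complexE.
move/rowP/(_ i): Re0; move/rowP/(_ i): Im0; rewrite !mxE => -> ->.
by rewrite mulr0 addr0.
Qed.

End SymmetricSecondEigenvalue.

(** * Reversible matrices with constant row sums *)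

Definition dirichlet (R : realType) (I : finType) (W : I -> I -> R)
    (x : I -> R) : R :=
  (\sum_i \sum_j W i j * (x i - x j) ^+ 2) / 2.

Lemma dirichletE (R : realType) (I : finType) (W : I -> I -> R) (x : I -> R) :
  (forall i j, W i j = W j i) ->
  dirichlet W x = \sum_i x i * \sum_j W i j * (x i - x j).
Proof.
move=> symW; rewrite /dirichlet.
pose a := \sum_i \sum_j x i * (W i j * (x i - x j)).
suff -> : \sum_i \sum_j W i j * (x i - x j) ^+ 2 = a + a.
  rewrite -mulr2n -[a *+ 2]mulr_natr mulfK ?pnatr_eq0 //.
  by apply: eq_bigr => i _; rewrite mulr_sumr.
have aE : a = \sum_i \sum_j x j * (W j i * (x j - x i)) by rewrite /a exchange_big.
rewrite {2}aE /a -big_split; apply: eq_bigr => i _ /=.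
rewrite -big_split; apply: eq_bigr => j _ /=.
by rewrite (symW j i); ring.
Qed.

(** The masses [m] are not normalized: for total mass 1 this is the variance. *)
Definition variance (R : realType) (I : finType) (m x : I -> R) : R :=
  \sum_i m i * x i ^+ 2 - (\sum_i m i * x i) ^+ 2 / \sum_i m i.

Lemma variance_shift (R : realType) (I : finType) (m x : I -> R) (a : R) :
  \sum_i m i != 0 ->
  \sum_i m i * (x i - a) ^+ 2 =
  variance m x + (\sum_i m i) * (a - (\sum_i m i * x i) / \sum_i m i) ^+ 2.
Proof.
move=> m0; rewrite /variance.
have -> : \sum_i m i * (x i - a) ^+ 2 =
    \sum_i m i * x i ^+ 2 - 2 * a * (\sum_i m i * x i) + a ^+ 2 * \sum_i m i.
  rewrite !mulr_sumr -sumrB -big_split; apply: eq_bigr => i _ /=; ring.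
by field.
Qed.

Lemma variance_le (R : realType) (I : finType) (m x : I -> R) (a : R) :
  0 < \sum_i m i -> variance m x <= \sum_i m i * (x i - a) ^+ 2.
Proof.
move=> m0; rewrite variance_shift ?gt_eqF // lerDl.
by apply: mulr_ge0; [exact: ltW | exact: sqr_ge0].
Qed.

(** Lagrange's identity: the variance is a sum over pairs, hence it grows when all
the pairwise distances grow. *)
Lemma variance_dirichlet (R : realType) (I : finType) (m x : I -> R) :
  0 < \sum_i m i ->
  (\sum_i m i) * variance m x = dirichlet (fun i j => m i * m j) x.
Proof.
move=> m0; rewrite dirichletE => [|i j]; last by rewrite mulrC.
have -> : \sum_i x i * \sum_j m i * m j * (x i - x j) =
    (\sum_j m j) * (\sum_i m i * x i ^+ 2) - (\sum_i m i * x i) ^+ 2.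
  rewrite expr2 mulr_sumr mulr_suml -sumrB; apply: eq_bigr => i _.
  rewrite mulr_sumr mulr_suml mulr_sumr -sumrB.
  by apply: eq_bigr => j _; ring.
by rewrite /variance; field; rewrite gt_eqF.
Qed.

(** Conjugating by the diagonal matrix of the square roots of the masses turns a
reversible matrix into a symmetric one with the same spectrum, for which the
square roots of the masses form the top eigenvector. *)
Section Reversible.

Variables (R : realType) (n : nat) (A : 'M[R]_n) (m : 'I_n -> R) (kappa : R).
Hypothesis m_gt0 : forall i, 0 < m i.
Hypothesis reversible : forall i j, m i * A i j = m j * A j i.
Hypothesis offdiag_ge0 : forall i j, i != j -> 0 <= A i j.
Hypothesis row_sum : forall i, \sum_j A i j = kappa.
Hypothesis n_gt1 : (1 < n)%N.

Let s i := Num.sqrt (m i).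
Let S : 'M[R]_n := \matrix_(i, j) (s i * A i j / s j).
Let u : 'rV[R]_n := \row_i s i.

Let s_gt0 i : 0 < s i. Proof. by rewrite sqrtr_gt0. Qed.
Let s_neq0 i : s i != 0. Proof. by rewrite gt_eqF. Qed.
Let s_sq i : s i ^+ 2 = m i. Proof. by rewrite sqr_sqrtr // ltW. Qed.

Let symS : S^T = S.
Proof.
apply/matrixP => i j; rewrite !mxE.
have : s i ^+ 2 * A i j = s j ^+ 2 * A j i by rewrite !s_sq.
move=> rev_ij; have -> : A i j = s j ^+ 2 * A j i / s i ^+ 2.
  by rewrite -rev_ij; field.
by field; rewrite !s_neq0.
Qed.

Let u_neq0 : u != 0.
Proof. by apply/rV0Pn; exists (Ordinal (ltnW n_gt1)); rewrite mxE. Qed.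

Let uS : u *m S = kappa *: u.
Proof.
apply/rowP => j; rewrite -{1}symS !mxE -(row_sum j) mulr_suml.
by apply: eq_bigr => i _; rewrite !mxE; field.
Qed.

Let second_eigenvalueS : second_eigenvalue S = second_eigenvalue A.
Proof.
rewrite /second_eigenvalue /spectrum (char_poly_intertwine (A := A) (P := diag_mx u)) //.
  rewrite unitmxE det_diag unitfE; apply/prodf_neq0 => i _.
  by rewrite mxE.
apply/matrixP => i j; rewrite mul_mx_diag mul_diag_mx !mxE.
by rewrite divfK.
Qed.

Let generator (x : 'I_n -> R) i :
  kappa * x i - \sum_j A i j * x j = \sum_j A i j * (x i - x j).
Proof.
rewrite -(row_sum i) mulr_suml -sumrB; apply: eq_bigr => j _; ring.
Qed.

Lemma reversible_dirichlet (x : 'I_n -> R) :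
  \sum_i m i * x i * (kappa * x i - \sum_j A i j * x j)
  = dirichlet (fun i j => m i * A i j) x.
Proof.
rewrite dirichletE //; apply: eq_bigr => i _.
rewrite generator -mulrA mulrCA; congr (_ * _); rewrite mulr_sumr.
by apply: eq_bigr => j _; ring.
Qed.

Lemma reversible_dirichlet_ge0 (x : 'I_n -> R) :
  0 <= dirichlet (fun i j => m i * A i j) x.
Proof.
apply: divr_ge0 => //; apply: sumr_ge0 => i _; apply: sumr_ge0 => j _.
have [->|ij] := eqVneq i j; first by rewrite subrr expr0n mulr0.
by rewrite mulr_ge0 ?sqr_ge0 // mulr_ge0 ?offdiag_ge0 // ltW.
Qed.

Let scale (x : 'I_n -> R) : 'rV[R]_n := \row_i (s i * x i).

Let scale_norm x : (scale x *m (scale x)^T) 0 0 = \sum_i m i * x i ^+ 2.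
Proof. by rewrite mxE; apply: eq_bigr => i _; rewrite !mxE -s_sq; ring. Qed.

Let scale_u x : (scale x *m u^T) 0 0 = \sum_i m i * x i.
Proof. by rewrite mxE; apply: eq_bigr => i _; rewrite !mxE -s_sq; ring. Qed.

Let scaleS x : scale x *m S = scale (fun i => \sum_j A i j * x j).
Proof.
apply/rowP => i; rewrite -{1}symS !mxE mulr_sumr; apply: eq_bigr => j _.
by rewrite !mxE; field.
Qed.

Let scale_form x : kappa * (scale x *m (scale x)^T) 0 0
  - (scale x *m S *m (scale x)^T) 0 0 = dirichlet (fun i j => m i * A i j) x.
Proof.
rewrite -reversible_dirichlet scale_norm scaleS mxE mulr_sumr -sumrB.
by apply: eq_bigr => i _; rewrite !mxE -s_sq; ring.
Qed.

Let scaleK (x : 'rV[R]_n) : scale (fun i => x 0 i / s i) = x.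
Proof. by apply/rowP => i; rewrite mxE mulrC divfK. Qed.

Let kappa_top (x : 'rV_n) : (x *m S *m x^T) 0 0 <= kappa * (x *m x^T) 0 0.
Proof. by rewrite -(scaleK x) -subr_ge0 scale_form reversible_dirichlet_ge0. Qed.

Let mass_gt0 : 0 < \sum_i m i.
Proof.
rewrite (bigD1 (Ordinal (ltnW n_gt1))) //= ltr_wpDr //.
by apply: sumr_ge0 => i _; apply: ltW.
Qed.

(** Both sides are invariant under translation of [x], so [x] can be centred; then
it becomes orthogonal to the top eigenvector. *)
Lemma spectral_gap (x : 'I_n -> R) :
  (kappa - second_eigenvalue A) * variance m x
  <= dirichlet (fun i j => m i * A i j) x.
Proof.
pose a := (\sum_i m i * x i) / \sum_i m i; pose y i := x i - a.
have -> : dirichlet (fun i j => m i * A i j) x = dirichlet (fun i j => m i * A i j) y.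
  rewrite /dirichlet; congr (_ / _); apply: eq_bigr => i _; apply: eq_bigr => j _.
  by rewrite /y; congr (_ * _ ^+ 2); ring.
have y0 : (scale y *m u^T) 0 0 = 0.
  rewrite scale_u /y; under eq_bigr do rewrite mulrBr.
  rewrite sumrB -mulr_suml /a; field; exact: lt0r_neq0.
have -> : variance m x = (scale y *m (scale y)^T) 0 0.
  rewrite scale_norm variance_shift ?lt0r_neq0 // /a subrr expr0n mulr0 addr0 //.
have := symmetric_rayleigh symS u_neq0 uS kappa_top n_gt1 y0.
rewrite second_eigenvalueS -scale_form => ray.
by rewrite mulrBl lerB.
Qed.

Lemma second_eigenvector :
  exists x : 'I_n -> R,
    [/\ exists i, x i != 0, \sum_i m i * x i = 0
      & forall i, \sum_j A i j * x j = second_eigenvalue A * x i].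
Proof.
have [x [x_neq0 xu xS]] :=
  symmetric_second_eigenvector symS u_neq0 uS kappa_top n_gt1.
have [y xE] : exists y, x = scale y by exists (fun i => x 0 i / s i); rewrite scaleK.
rewrite {x}xE in x_neq0 xu xS; exists y; split.
- have /rV0Pn[j yj] := x_neq0; exists j; move: yj.
  by rewrite mxE mulf_eq0 negb_or => /andP[].
- by rewrite -scale_u.
move=> i; have /rowP/(_ i) := xS; rewrite scaleS second_eigenvalueS !mxE.
by rewrite mulrCA => /(mulfI (s_neq0 i)).
Qed.

End Reversible.

(** * The tridiagonal matrices T(k, s, b) *)

Section Tridiagonal.

Variables (R : realType) (k : nat).
Hypothesis k_ge2 : (2 <= k)%N.

(** The number of vertices at distance [i] from a vertex of the k-regular tree. *)
Definition sphere (i : nat) : R :=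
  if i is j.+1 then k%:R * (k%:R - 1) ^+ j else 1.

(** The reversing weights of T(k, m + 2, b). *)
Definition mass (m : nat) (b : R) (i : nat) : R :=
  if (i <= m)%N then sphere i else sphere i / b.

(** The Dirichlet form of T(k, m + 2, b): the conductance of the edge between [i]
and [i + 1] is the number of edges of the tree between the two spheres, whatever
[b] is. *)
Definition chain_energy (m : nat) (x : nat -> R) : R :=
  \sum_(i < m.+1) sphere i.+1 * (x i - x i.+1) ^+ 2.

Lemma sphereS (i : nat) :
  sphere i.+1 = sphere i * (if i == 0%N then k%:R else k%:R - 1).
Proof. by case: i => [|i] /=; rewrite ?expr0 ?mulr1 ?mul1r // exprSr mulrA. Qed.

Lemma valency_gt1 : 1 < k%:R :> R.
Proof. by rewrite ltr1n. Qed.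

Lemma sphere_gt0 (i : nat) : 0 < sphere i.
Proof.
have k1 := valency_gt1; case: i => [|i] //=.
by apply: mulr_gt0; [lra | apply: exprn_gt0; lra].
Qed.

Lemma sum_at (n i : nat) (F : nat -> R) :
  \sum_(j < n) (if j == i :> nat then F j else 0) =
  if (i < n)%N then F i else 0.
Proof.
case: ltnP => [lt_in|le_ni].
  rewrite (bigD1 (Ordinal lt_in)) //= eqxx.
  by rewrite big1 ?addr0 // => j; rewrite -val_eqE /= => /negPf->.
rewrite big1 // => j _; case: eqP => // ji.
by have := ltn_ord j; rewrite ji ltnNge le_ni.
Qed.

Lemma sum_neighbours (n : nat) (F : nat -> nat -> R) :
  \sum_(i < n.+1) \sum_(j < n.+1)
     (if i == j.+1 :> nat then F i j else if j == i.+1 :> nat then F i j else 0)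
  = \sum_(i < n) (F i.+1 i + F i i.+1).
Proof.
have split_if (i j : nat) :
    (if i == j.+1 :> nat then F i j else if j == i.+1 :> nat then F i j else 0) =
    (if i == j.+1 :> nat then F i j else 0) + (if j == i.+1 :> nat then F i j else 0).
  case: eqP => [->|_]; last by rewrite add0r.
  by case: eqP => [|_]; [lia | rewrite addr0].
under eq_bigr => i _ do under eq_bigr => j _ do rewrite split_if.
under eq_bigr => i _ do rewrite big_split /=.
rewrite big_split /= exchange_big /= big_split /=; congr (_ + _).
  under eq_bigr => j _ do rewrite (sum_at n.+1 j.+1 (fun i => F i j)).
  rewrite big_ord_recr /= ltnn addr0; apply: eq_bigr => i _.
  by rewrite ltnS ltn_ord.
under eq_bigr => i _ do rewrite (sum_at n.+1 i.+1 (F i)).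
rewrite big_ord_recr /= ltnn addr0; apply: eq_bigr => i _.
by rewrite ltnS ltn_ord.
Qed.

(** The equality case of the triangle inequality. *)
Lemma same_sign_of_norm_sum (n : nat) (d : 'I_n -> R) :
  \sum_i `|d i| <= `|\sum_i d i| ->
  (forall i, 0 <= d i) \/ (forall i, d i <= 0).
Proof.
have nonneg (e : 'I_n -> R) : \sum_i `|e i| <= \sum_i e i -> forall i, 0 <= e i.
  rewrite -subr_ge0 -sumrB => le_sum i.
  have : e i - `|e i| >= 0.
    apply: le_trans le_sum _; rewrite (bigD1 i) //= gerDl.
    by apply: sumr_le0 => j _; rewrite subr_le0 ler_norm.
  by rewrite subr_ge0; apply: le_trans.
case: (ger0P (\sum_i d i)) => [_|_ le_sum]; first by left; apply: nonneg.
right=> i; rewrite -oppr_ge0; apply: (nonneg (fun i => - d i)).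
by under eq_bigr do rewrite normrN; rewrite sumrN.
Qed.

Section FixedSize.

Variables (m : nat) (b : R).
Hypothesis b_gt0 : 0 < b.

Let off : 'M[R]_m.+2 := T_offdiag k m.+2 b.
Let A : 'M[R]_m.+2 := T k m.+2 b.
Let mu (i : 'I_m.+2) : R := mass m b i.
Let lambda : R := second_eigenvalue A.

Lemma mass_gt0 (i : nat) : 0 < mass m b i.
Proof. by rewrite /mass; case: ifP => _; rewrite ?divr_gt0 ?sphere_gt0. Qed.

Lemma sum_mass : \sum_(i < m.+2) mu i = M k m.+2 b.
Proof.
rewrite /M subn2 big_ord_recr big_ord_recl /= /mu /mass ltnn /=.
rewrite -!addrA; congr (_ + (_ + _)); apply: eq_bigr => i _.
by rewrite /bump add1n ltn_ord.
Qed.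

Lemma mass_offdiag (i j : 'I_m.+2) : mu i * off i j =
  if i == j.+1 :> nat then sphere i else if j == i.+1 :> nat then sphere j else 0.
Proof.
rewrite /mu /off mxE; case: eqP => [ij|_].
  rewrite /mass eqSS; have [->|im] := eqVneq (i : nat) m.+1.
    by rewrite ltnn divfK // gt_eqF.
  by rewrite mulr1 -ltnS ltn_neqAle im -ltnS ltn_ord.
case: eqP => [ji|_]; last by rewrite mulr0.
have im : (i <= m)%N by have := ltn_ord j; rewrite ji !ltnS.
by rewrite /mass im ji sphereS.
Qed.

Lemma T_reversible (i j : 'I_m.+2) : mu i * A i j = mu j * A j i.
Proof.
rewrite !mxE !mulrDr; congr (_ + _).
  have := mass_offdiag i j; have := mass_offdiag j i; rewrite !mxE => -> ->.
  by case: eqP => [ij|_]; case: eqP => [ji|_] //; lia.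
by rewrite eq_sym; case: eqP => [->//|_]; rewrite !mulr0n !mulr0.
Qed.

Lemma T_offdiag_ge0 (i j : 'I_m.+2) : 0 <= off i j.
Proof.
have : 0 <= mu i * off i j.
  by rewrite mass_offdiag; case: ifP => _; last case: ifP => _; rewrite // ltW ?sphere_gt0.
by rewrite pmulr_rge0 // mass_gt0.
Qed.

Lemma T_nondiag (i j : 'I_m.+2) : i != j -> A i j = off i j.
Proof. by move=> /negPf ij; rewrite /A /T !mxE ij addr0. Qed.

Lemma T_row_sum (i : 'I_m.+2) : \sum_j A i j = k%:R.
Proof.
pose D i j := (k%:R - \sum_j' off i j') *+ (i == j).
have -> : \sum_j A i j = \sum_j off i j + \sum_j D i j.
  by rewrite -big_split; apply: eq_bigr => j _; rewrite /A /T !mxE.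
rewrite (bigD1 i (F := D i)) //= [X in _ + (_ + X)]big1 => [|j /negPf ij]; last first.
  by rewrite /D eq_sym ij.
by rewrite addr0 /D eqxx mulr1n addrC subrK.
Qed.

Lemma T_dirichlet (x : nat -> R) :
  dirichlet (fun i j => mu i * A i j) (fun i : 'I_m.+2 => x i) = chain_energy m x.
Proof.
pose F i j := (if (i <= j)%N then sphere j else sphere i) * (x i - x j) ^+ 2.
rewrite /dirichlet.
transitivity ((\sum_(i < m.+2) \sum_(j < m.+2)
  (if i == j.+1 :> nat then F i j else if j == i.+1 :> nat then F i j else 0)) / 2).
  congr (_ / _); apply: eq_bigr => i _; apply: eq_bigr => j _.
  have [->|ij] := eqVneq i j.
    by rewrite /F subrr expr0n !mulr0; case: ifP => // _; case: ifP.
  rewrite T_nondiag // mass_offdiag /F; case: eqP => [->|_].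
    by rewrite ltnn.
  by case: eqP => [->|_]; rewrite ?leqnSn ?mul0r.
rewrite sum_neighbours /chain_energy mulr_suml; apply: eq_bigr => i _.
by rewrite /F ltnn leqnSn; field.
Qed.

Lemma T_gap (x : nat -> R) :
  (k%:R - lambda) * variance mu (fun i => x i) <= chain_energy m x.
Proof.
rewrite -T_dirichlet; apply: spectral_gap => //.
- by move=> i; apply: mass_gt0.
- exact: T_reversible.
- by move=> i j ij; rewrite T_nondiag // T_offdiag_ge0.
- exact: T_row_sum.
Qed.

Lemma T_mulvec (x : nat -> R) (i : 'I_m.+2) :
  \sum_j A i j * x j = k%:R * x i - \sum_j off i j * (x i - x j).
Proof.
rewrite -(T_row_sum i) mulr_suml -sumrB; apply: eq_bigr => j _.
by have [->|ij] := eqVneq i j; [rewrite subrr | rewrite -T_nondiag //]; ring.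
Qed.

Lemma T_row0 (x : nat -> R) : \sum_j A ord0 j * x j = k%:R * x 1%N.
Proof.
rewrite T_mulvec (_ : \sum_j _ = k%:R * (x 0%N - x 1%N)) /=; first by ring.
transitivity (\sum_(j < m.+2) (if j == 1%N :> nat then k%:R * (x 0%N - x j) else 0)).
  by apply: eq_bigr => j _; rewrite mxE /=; case: eqP => // _; rewrite mul0r.
by rewrite (sum_at m.+2 1 (fun j => k%:R * (x 0%N - x j))).
Qed.

Lemma T_rowS (x : nat -> R) (i : 'I_m.+2) (l : nat) : i = l.+1 :> nat -> (l < m)%N ->
  \sum_j A i j * x j = x l + (k%:R - 1) * x l.+2.
Proof.
move=> il lm; rewrite T_mulvec il.
rewrite (_ : \sum_j _ = (x l.+1 - x l) + (k%:R - 1) * (x l.+1 - x l.+2)) /=; first by ring.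
transitivity (\sum_(j < m.+2) ((if j == l :> nat then x l.+1 - x j else 0) +
   (if j == l.+2 :> nat then (k%:R - 1) * (x l.+1 - x j) else 0))).
  apply: eq_bigr => j _; rewrite mxE il eqSS (eq_sym l) /=.
  rewrite (_ : l.+2 == m.+2 = false); last by lia.
  case: eqP => [->|_]; first by rewrite ltn_eqF ?mul1r ?addr0 //; lia.
  by rewrite add0r; case: eqP => _; rewrite ?mul0r.
rewrite big_split /= (sum_at m.+2 l (fun j => x l.+1 - x j)).
rewrite (sum_at m.+2 l.+2 (fun j => (k%:R - 1) * (x l.+1 - x j))).
by rewrite !ltnS lm (_ : (l <= m.+1)%N) //; lia.
Qed.

Lemma mass_sum_gt0 : 0 < \sum_i mu i.
Proof.
rewrite big_ord_recl ltr_wpDr ?mass_gt0 //.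
by apply: sumr_ge0 => i _; rewrite ltW ?mass_gt0.
Qed.

Lemma T_eigenvector : exists x : nat -> R,
  [/\ exists i : 'I_m.+2, x i != 0, \sum_(i < m.+2) mu i * x i = 0
    & forall i : 'I_m.+2, \sum_j A i j * x j = lambda * x i].
Proof.
have [|i j||||x [[i0 xi0] sum0 xA]] :=
  second_eigenvector (A := A) (m := mu) (kappa := k%:R).
- by move=> i; apply: mass_gt0.
- exact: T_reversible.
- by move=> i j ij; rewrite T_nondiag // T_offdiag_ge0.
- exact: T_row_sum.
- by [].
exists (fun i => x (inord i)); split.
- by exists i0; rewrite inord_val.
- by rewrite -[RHS]sum0; apply: eq_bigr => i _; rewrite inord_val.
move=> i; rewrite inord_val -xA.
by apply: eq_bigr => j _; rewrite inord_val.
Qed.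

Section Eigenvector.

Variable x : nat -> R.
Hypothesis x_neq0 : exists i : 'I_m.+2, x i != 0.
Hypothesis x_sum0 : \sum_(i < m.+2) mu i * x i = 0.
Hypothesis x_eigen : forall i : 'I_m.+2, \sum_j A i j * x j = lambda * x i.

Lemma eigenvector_norm_gt0 : 0 < \sum_(i < m.+2) mu i * x i ^+ 2.
Proof.
have [i xi] := x_neq0; rewrite (bigD1 i) //= ltr_wpDr //.
  by apply: sumr_ge0 => j _; rewrite mulr_ge0 ?sqr_ge0 // ltW ?mass_gt0.
by rewrite mulr_gt0 ?mass_gt0 // exprn_even_gt0.
Qed.

Lemma eigenvector_energy :
  chain_energy m x = (k%:R - lambda) * \sum_(i < m.+2) mu i * x i ^+ 2.
Proof.
rewrite -T_dirichlet -(reversible_dirichlet (kappa := k%:R)); last 2 first.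
- exact: T_reversible.
- exact: T_row_sum.
by rewrite mulr_sumr; apply: eq_bigr => i _; rewrite x_eigen; ring.
Qed.

(** Otherwise the energy of [x] vanishes, so that [x] is constant; having mean zero,
it is zero. *)
Lemma second_eigenvalue_T_lt : lambda < k%:R.
Proof.
rewrite -subr_gt0 -(pmulr_lgt0 _ eigenvector_norm_gt0) -eigenvector_energy.
rewrite lt_neqAle eq_sym; apply/andP; split; last first.
  by apply: sumr_ge0 => i _; rewrite mulr_ge0 ?sqr_ge0 // ltW ?sphere_gt0.
apply/negP => /eqP energy0.
have x_step (i : 'I_m.+1) : x i = x i.+1.
  have /psumr_eq0P/(_ energy0 i isT)/eqP : forall i : 'I_m.+1, true ->
      0 <= sphere i.+1 * (x i - x i.+1) ^+ 2.
    by move=> j _; rewrite mulr_ge0 ?sqr_ge0 // ltW ?sphere_gt0.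
  by rewrite mulf_eq0 gt_eqF ?sphere_gt0 //= expf_eq0 subr_eq0 => /eqP.
have x_const i : (i < m.+2)%N -> x i = x 0%N.
  elim: i => [//|i IHi] lt_i; rewrite -(IHi (ltnW lt_i)).
  exact: esym (x_step (Ordinal (lt_i : (i < m.+1)%N))).
have x0 : x 0%N = 0.
  move: x_sum0; under eq_bigr do rewrite x_const ?ltn_ord //.
  by rewrite -mulr_suml => /eqP; rewrite mulf_eq0 gt_eqF ?mass_sum_gt0 // => /eqP.
have [j +] := x_neq0; by rewrite x_const ?ltn_ord // x0 eqxx.
Qed.

Lemma eigenvector_variance :
  variance mu (fun i => x i) = \sum_(i < m.+2) mu i * x i ^+ 2.
Proof. by rewrite /variance x_sum0 expr0n mul0r subr0. Qed.

Lemma telescope_diff (y : nat -> R) (n : nat) :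
  \sum_(i < n) (y i - y i.+1) = y 0%N - y n.
Proof.
elim: n => [|n IHn]; first by rewrite big_ord0 subrr.
by rewrite big_ord_recr /= IHn addrA subrK.
Qed.

(** The rearrangement with the absolute differences has the same energy and spreads
every pair of values at least as much.  As [x] minimizes the ratio of energy to
variance, no pair is spread more; for the two end points this says that the
absolute differences and the differences have sums of the same size. *)
Lemma eigenvector_monotone :
  (forall i, (i <= m)%N -> x i.+1 <= x i) \/ (forall i, (i <= m)%N -> x i <= x i.+1).
Proof.
pose y i := - \sum_(j < i) `|x j - x j.+1|.
have y_step i : y i - y i.+1 = `|x i - x i.+1|.
  by rewrite /y big_ord_recr /= opprK addrA addNr add0r.
have energy_y : chain_energy m y = chain_energy m x.
  by apply: eq_bigr => i _; rewrite y_step real_normK // num_real.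
have spread (i j : nat) : (i <= j)%N -> `|x i - x j| <= `|y i - y j|.
  move=> /subnKC <-; elim: (j - i)%N => [|l IHl]; first by rewrite addn0 !subrr.
  have -> : y i - y (i + l.+1)%N = (y i - y (i + l)%N) + `|x (i + l)%N - x (i + l).+1|.
    by rewrite -y_step addnS addrA subrK.
  have y_ge0 : 0 <= y i - y (i + l)%N.
    elim: l {IHl} => [|l IHl]; first by rewrite addn0 subrr.
    have := y_step (i + l)%N; have := normr_ge0 (x (i + l)%N - x (i + l).+1).
    by rewrite addnS; lra.
  rewrite [leRHS]ger0_norm; last exact: addr_ge0.
  rewrite [X in _ <= X]ger0_norm // in IHl.
  rewrite addnS.
  rewrite (_ : x i - _ = (x i - x (i + l)%N) + (x (i + l)%N - x (i + l).+1));
    last by ring.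
  by apply: le_trans (ler_normD _ _) _; rewrite lerD2r.
have var_le : variance mu (fun i => y i) <= variance mu (fun i => x i).
  rewrite -(ler_pM2l (_ : 0 < k%:R - lambda)) ?subr_gt0 ?second_eigenvalue_T_lt //.
  by rewrite eigenvector_variance -eigenvector_energy -energy_y T_gap.
have pair_le (i j : 'I_m.+2) :
    0 <= mu i * mu j * (y i - y j) ^+ 2 - mu i * mu j * (x i - x j) ^+ 2.
  rewrite -mulrBr mulr_ge0 //; first by rewrite mulr_ge0 // ltW ?mass_gt0.
  rewrite subr_ge0 -[leLHS]real_normK ?num_real // -[leRHS]real_normK ?num_real //.
  rewrite ler_pXn2r ?nnegrE //; have [/spread//|/ltnW/spread] := leqP i j.
  by rewrite distrC [leRHS]distrC.
have ends : `|y 0%N - y m.+1| <= `|x 0%N - x m.+1|.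
  move: var_le; rewrite -(ler_pM2l mass_sum_gt0) !variance_dirichlet ?mass_sum_gt0 //.
  rewrite /dirichlet ler_pM2r ?invr_gt0 ?ltr0n // -subr_le0 -sumrB => sum_le0.
  have : mu ord0 * mu ord_max * (y 0%N - y m.+1) ^+ 2
         - mu ord0 * mu ord_max * (x 0%N - x m.+1) ^+ 2 <= 0.
    apply: le_trans sum_le0; rewrite (bigD1 ord0) //= ler_wpDr //.
      by apply: sumr_ge0 => i _; rewrite -sumrB; apply: sumr_ge0 => j _.
    rewrite -sumrB (bigD1 ord_max) //= ler_wpDr //.
    by apply: sumr_ge0 => j _; apply: pair_le.
  rewrite -mulrBr pmulr_rle0 ?mulr_gt0 ?mass_gt0 // subr_le0.
  rewrite -[leLHS]real_normK ?num_real // -[leRHS]real_normK ?num_real //.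
  by rewrite ler_pXn2r ?nnegrE.
have le_sum : \sum_(i < m.+1) `|x i - x i.+1| <= `|\sum_(i < m.+1) (x i - x i.+1)|.
  rewrite telescope_diff; apply: le_trans ends.
  rewrite -telescope_diff; under [X in _ <= `|X|]eq_bigr do rewrite y_step.
  exact: ler_norm.
have [pos|neg] := same_sign_of_norm_sum le_sum.
  left=> i im; rewrite -subr_ge0.
  exact: (pos (Ordinal (im : (i < m.+1)%N))).
right=> i im; rewrite -subr_le0.
exact: (neg (Ordinal (im : (i < m.+1)%N))).
Qed.

End Eigenvector.

(** A nonincreasing nonzero vector of mean zero has a negative last entry.  The last
row of the eigenvalue equation is left out: it is the only one where [b] occurs, and
its content survives in the mean being zero. *)
Lemma T_decreasing_eigenvector : exists x : nat -> R,
  [/\ x m.+1 < 0, forall i, (i <= m)%N -> x m.+1 <= x i,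
      \sum_(i < m.+2) mu i * x i = 0
    & k%:R * x 1%N = lambda * x 0%N /\
      forall i, (i < m)%N -> x i + (k%:R - 1) * x i.+2 = lambda * x i.+1].
Proof.
have [x [x_neq0 x_sum0 xA]] : exists x : nat -> R,
  [/\ exists i : 'I_m.+2, x i != 0, \sum_(i < m.+2) mu i * x i = 0,
      forall i : 'I_m.+2, \sum_j A i j * x j = lambda * x i
    & forall i, (i <= m)%N -> x i.+1 <= x i].
  have [x [[i0 xi0] x_sum0 xA]] := T_eigenvector.
  have [decr|incr] := eigenvector_monotone (ex_intro _ i0 xi0) x_sum0 xA.
    by exists x; split=> //; exists i0.
  exists (fun i => - x i); split.
  - by exists i0; rewrite oppr_eq0.
  - by under eq_bigr do rewrite mulrN; rewrite sumrN x_sum0 oppr0.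
  - by move=> i; under eq_bigr do rewrite mulrN; rewrite sumrN xA mulrN.
  by move=> i im; rewrite lerN2 incr.
move=> decr; exists x.
have last_min i : (i <= m.+1)%N -> x m.+1 <= x i.
  move=> /subKn <-; elim: (m.+1 - i)%N => [|l IHl]; first by rewrite subn0.
  have [lm|ml] := leqP m.+1 l; first by rewrite (_ : m.+1 - l.+1 = m.+1 - l)%N //; lia.
  apply: le_trans IHl _; rewrite (_ : m.+1 - l = (m.+1 - l.+1).+1)%N; last by lia.
  by apply: decr; lia.
split.
- rewrite ltNge; apply/negP => last_ge0; have [j /negP[]] := x_neq0.
  have x_ge0 (i : 'I_m.+2) : true -> 0 <= mu i * x i.
    move=> _; rewrite mulr_ge0 ?(ltW (mass_gt0 _)) //.
    by apply: le_trans last_ge0 (last_min _ _); rewrite -ltnS.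
  have /psumr_eq0P/(_ x_sum0 j isT)/eqP := x_ge0.
  by rewrite mulf_eq0 gt_eqF ?mass_gt0.
- by move=> i im; apply: last_min; apply: leqW.
- by [].
split; first by rewrite -T_row0 (xA ord0).
move=> i im; have lt_i : (i.+1 < m.+2)%N by rewrite !ltnS ltnW.
by rewrite -(@T_rowS x (Ordinal lt_i) i) // xA.
Qed.

End FixedSize.

(** The eigenvector of the first matrix, transplanted to the second one without
change of energy and without loss of spread about any centre, is a test function
for the second spectral gap. *)
Lemma second_eigenvalue_T_le (m m' : nat) (b b' : R) : 0 < b -> 0 < b' ->
  (forall x : nat -> R, exists2 y : nat -> R,
     chain_energy m' y = chain_energy m x
   & forall a, \sum_(i < m.+2) mass m b i * (x i - a) ^+ 2
            <= \sum_(i < m'.+2) mass m' b' i * (y i - a) ^+ 2) ->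
  second_eigenvalue (T k m.+2 b) <= second_eigenvalue (T k m'.+2 b').
Proof.
move=> b_gt0 b'_gt0 transplant.
have [x [x_neq0 x_sum0 xA]] := T_eigenvector m b_gt0.
have [y energy_y spread_y] := transplant x.
have N_gt0 := eigenvector_norm_gt0 b_gt0 x_neq0.
have lt_k := second_eigenvalue_T_lt b_gt0 x_neq0 x_sum0 xA.
have gap := T_gap m' b'_gt0 y.
rewrite energy_y (eigenvector_energy b_gt0 xA) in gap.
have NV : \sum_(i < m.+2) mass m b i * x i ^+ 2
    <= variance (fun i : 'I_m'.+2 => mass m' b' i) (fun i => y i).
  rewrite -(eigenvector_variance x_sum0).
  have M_gt0 := mass_sum_gt0 m b_gt0; have M'_gt0 := mass_sum_gt0 m' b'_gt0.
  set a := (\sum_(i < m'.+2) mass m' b' i * y i) / \sum_(i < m'.+2) mass m' b' i.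
  have <- : \sum_(i < m'.+2) mass m' b' i * (y i - a) ^+ 2 =
      variance (fun i : 'I_m'.+2 => mass m' b' i) (fun i => y i).
    by rewrite variance_shift ?gt_eqF // /a subrr expr0n mulr0 addr0.
  exact: le_trans (variance_le _ a M_gt0) (spread_y a).
have : (k%:R - second_eigenvalue (T k m'.+2 b'))
        * variance (fun i : 'I_m'.+2 => mass m' b' i) (fun i => y i)
    <= (k%:R - second_eigenvalue (T k m.+2 b))
        * variance (fun i : 'I_m'.+2 => mass m' b' i) (fun i => y i).
  by apply: le_trans gap _; rewrite ler_pM2l ?subr_gt0.
by rewrite ler_pM2r ?(lt_le_trans N_gt0) // lerD2l lerN2.
Qed.

Lemma second_eigenvalue_T_last (m : nat) (b b' : R) : 0 < b' -> b' <= b ->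
  second_eigenvalue (T k m.+2 b) <= second_eigenvalue (T k m.+2 b').
Proof.
move=> b'_gt0 le_b; have b_gt0 : 0 < b := lt_le_trans b'_gt0 le_b.
apply: second_eigenvalue_T_le => // x; exists x => // a.
apply: ler_sum => i _; rewrite ler_wpM2r ?sqr_ge0 // /mass.
by case: ifP => // _; rewrite ler_pM2l ?sphere_gt0 // lef_pV2.
Qed.

Lemma second_eigenvalue_T_extend (m : nat) (b : R) : 0 < b ->
  second_eigenvalue (T k m.+2 (1 : R)) <= second_eigenvalue (T k m.+3 b).
Proof.
move=> b_gt0; apply: second_eigenvalue_T_le => // x.
(* The extension by the last value adds no energy. *)
exists (fun i => x (minn i m.+1)) => [|a].
  rewrite /chain_energy big_ord_recr /= minnn (minn_idPr (leqnSn _)) subrr.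
  rewrite expr0n mulr0 addr0; apply: eq_bigr => i _.
  by rewrite (minn_idPl _) ?(ltnW (ltn_ord i)) // (minn_idPl (ltn_ord i)).
rewrite [leRHS]big_ord_recr /= ler_wpDr //.
  by rewrite mulr_ge0 ?sqr_ge0 // ltW ?mass_gt0.
rewrite le_eqVlt; apply/orP; left; apply/eqP; apply: eq_bigr => i _ /=.
have le_im : (i <= m.+1)%N by rewrite -ltnS ltn_ord.
by rewrite (minn_idPl le_im) /mass divr1 if_same le_im.
Qed.

End Tridiagonal.

(** * Non-backtracking walks in a regular graph *)

Section NonBacktrackingWalks.
Local Open Scope nat_scope.

Variables (V : finType) (e : rel V) (k : nat) (u : V).
Hypothesis e_sym : symmetric e.
Hypothesis e_reg : forall x, #|[set y | e x y]| = k.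

(** The number of non-backtracking walks of length [i + 1] from [u] whose last step
goes from [y] to [x]; remembering the last step makes the recursion possible. *)
Fixpoint nbw_dart (i : nat) (y x : V) : nat :=
  if i is j.+1 then e y x * \sum_(z | z != x) nbw_dart j z y
  else (y == u) && e y x.

Definition nbw (i : nat) (x : V) : nat :=
  if i is j.+1 then \sum_y nbw_dart j y x else x == u.

(** The number of ways to prolong a non-backtracking walk of length [i]. *)
Definition branching (i : nat) : nat := if i == 0 then k else k.-1.

Lemma sum_adj (x : V) : \sum_y (e x y : nat) = k.
Proof.
rewrite -(e_reg x) -sum1dep_card [RHS]big_mkcond.
by apply: eq_bigr => y _; case: e.
Qed.

Lemma nbw_dart_adj (i : nat) (y x : V) : nbw_dart i y x = e y x * nbw_dart i y x.
Proof. by case: i => [|i] /=; case: (e y x); rewrite ?mul1n ?andbF. Qed.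

Lemma sum_nbw_dart (i : nat) (y : V) :
  \sum_x nbw_dart i y x = branching i * nbw i y.
Proof.
case: i => [|i] /=.
  rewrite /branching /=; case: (y == u); last by rewrite muln0 big1.
  by rewrite muln1 -(sum_adj y).
under eq_bigr => x _ do rewrite big_distrr big_mkcond /=.
rewrite exchange_big big_distrr; apply: eq_bigr => z _ /=.
rewrite nbw_dart_adj; case ezy : (e z y); last first.
  by rewrite mul0n muln0 big1 // => x _; case: ifP => _; rewrite ?muln0.
have -> : branching i.+1 = \sum_(x | x != z) e y x.
  by rewrite /branching /= -(sum_adj y) (bigD1 z) //= (e_sym y z) ezy.
rewrite mul1n big_distrl [RHS]big_mkcond /=; apply: eq_bigr => x _.
by rewrite eq_sym; case: ifP; rewrite ?muln0.
Qed.

(** Prolonging a walk of length [i] by one step gives a non-backtracking walk or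
undoes the last step; in the second case the walk that remains has length
[i - 1], and it arises once for each of its prolongations. *)
Lemma nbw_recurrence (i : nat) (x : V) :
  \sum_y e x y * nbw i y =
  nbw i.+1 x + (if i is j.+1 then branching j * nbw j x else 0).
Proof.
case: i => [|i].
  rewrite addn0 /=; apply: eq_bigr => y _.
  by rewrite e_sym mulnC; case: (y == u); case: (e y x).
rewrite -sum_nbw_dart /= -big_split; apply: eq_bigr => y _ /=.
rewrite (bigD1 x) //= mulnDr addnC e_sym; congr (_ + _).
by rewrite [RHS]nbw_dart_adj e_sym.
Qed.

Lemma sum_nbw (i : nat) :
  \sum_x nbw i.+1 x = branching i * \sum_x nbw i x.
Proof.
rewrite /= exchange_big /= big_distrr /=.
by apply: eq_bigr => y _; rewrite sum_nbw_dart.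
Qed.

Lemma sum_nbw0 : \sum_x nbw 0 x = 1.
Proof. by rewrite /= (bigD1 u) //= eqxx big1 // => x /negPf->. Qed.

End NonBacktrackingWalks.

Lemma sum_nbw_sphere (R : realType) (V : finType) (e : rel V) (k : nat) (u : V)
    (i : nat) :
  symmetric e -> (forall x, #|[set y | e x y]| = k) -> (0 < k)%N ->
  \sum_x (nbw e u i x)%:R = sphere R k i.
Proof.
move=> e_sym e_reg k_gt0; rewrite -natr_sum.
elim: i => [|i IHi]; first by rewrite sum_nbw0.
rewrite (sum_nbw (k := k)) // natrM IHi sphereS mulrC /branching; congr (_ * _).
by case: ifP => // _; rewrite -subn1 natrB.
Qed.

(** * The order bound *)

Section RegularGraph.

Variables (R : realType) (k : nat) (G : sgraph).
Hypothesis k_ge2 : (2 <= k)%N.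
Hypothesis G_conn : connected G.
Hypothesis G_reg : regular k G.

Lemma order_gt1 : (1 < order_of G)%N.
Proof.
have [G_gt0 _] := G_conn; have /card_gt0P[x _] := G_gt0.
by apply: leq_trans k_ge2 _; rewrite -(G_reg x) max_card.
Qed.

Lemma sum_enum_val (F : vertex G -> R) :
  \sum_(i < order_of G) F (enum_val i) = \sum_x F x.
Proof.
by rewrite [RHS](reindex (@enum_val _ (vertex G))) //; apply/onW_bij/enum_val_bij.
Qed.

Lemma sum_adj_real (x : vertex G) : \sum_y (adj x y)%:R = k%:R :> R.
Proof. by rewrite -natr_sum (sum_adj (e := @adj G) (k := k)). Qed.

Lemma regular_gap (w : vertex G -> R) :
  (k%:R - second_eigenvalue (adjacency R G))
    * (\sum_x w x ^+ 2 - (\sum_x w x) ^+ 2 / (order_of G)%:R)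
  <= \sum_x w x * (k%:R * w x - \sum_y (adj x y)%:R * w y).
Proof.
pose A := adjacency R G; pose m (i : 'I_(order_of G)) : R := 1.
have m_gt0 i : 0 < m i by [].
have A_rev i j : m i * A i j = m j * A j i by rewrite !mxE adj_sym.
have A_ge0 i j : i != j -> 0 <= A i j by rewrite mxE ler0n.
have A_row i : \sum_j A i j = k%:R.
  rewrite -(sum_adj_real (enum_val i)) -sum_enum_val.
  by apply: eq_bigr => j _; rewrite mxE.
have := spectral_gap m_gt0 A_rev A_ge0 A_row order_gt1 (fun i => w (enum_val i)).
rewrite -(reversible_dirichlet A_rev A_row) /variance.
rewrite -(sum_enum_val (fun x => w x ^+ 2)) -(sum_enum_val w).
rewrite -(sum_enum_val (fun x => w x * (k%:R * w x - \sum_y (adj x y)%:R * w y))).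
congr (_ * (_ - _ / _) <= _).
- by apply: eq_bigr => i _; rewrite mul1r.
- by congr (_ ^+ 2); apply: eq_bigr => i _; rewrite mul1r.
- by rewrite sumr_const card_ord.
apply: eq_bigr => i _; rewrite mul1r -sum_enum_val; congr (_ * (_ - _)).
by apply: eq_bigr => j _; rewrite mxE.
Qed.

End RegularGraph.

Lemma adj_nbw (R : realType) (k : nat) (G : sgraph) (u x : vertex G) (i : nat) :
  (0 < k)%N -> regular k G ->
  \sum_y (adj x y)%:R * (nbw (@adj G) u i y)%:R =
  (nbw (@adj G) u i.+1 x)%:R
  + (if i is j.+1 then (if j == 0%N then k%:R else k%:R - 1)
                       * (nbw (@adj G) u j x)%:R else 0) :> R.
Proof.
move=> k_gt0 G_reg; have := nbw_recurrence u (@adj_sym G) G_reg i x.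
move/(congr1 (fun l : nat => l%:R : R)); rewrite natr_sum natrD.
under eq_bigr do rewrite natrM.
move=> ->; congr (_ + _); case: i => // i; rewrite natrM /branching.
by case: ifP => // _; rewrite -subn1 natrB.
Qed.

(** For [h i = phi i - phi m.+1] the two equations hold with the same constant
[delta], since subtracting a constant from an eigenvector of T changes every row
of the eigenvalue equation by the same amount; [h] vanishes at [m.+1], so [w]
involves walks of length at most [m] only.  The last line of the proof multiplies
[h i * N i x] by [sum_j N j x], which is at least 1 when [N i x] is not zero. *)
Lemma radial_superharmonic (R : realType) (k m : nat) (G : sgraph)
    (u x : vertex G) (h : nat -> R) (w : vertex G -> R) (lambda delta : R) :
  (0 < k)%N -> regular k G ->
  (forall i, (i <= m)%N -> 0 <= h i) -> h m.+1 = 0 -> 0 <= delta ->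
  k%:R * h 1%N - lambda * h 0%N = delta ->
  (forall i, (i < m)%N -> h i + (k%:R - 1) * h i.+2 - lambda * h i.+1 = delta) ->
  (forall y, w y = \sum_(i < m.+1) h i * (nbw (@adj G) u i y)%:R) ->
  delta * w x <= w x * (\sum_y (adj x y)%:R * w y - lambda * w x).
Proof.
move=> k_gt0 G_reg h_ge0 h_last delta_ge0 eq0 eqS wE.
pose N i y : R := (nbw (@adj G) u i y)%:R.
pose up i : R := if i == 0%N then k%:R else k%:R - 1.
have Aw : \sum_y (adj x y)%:R * w y - lambda * w x =
    delta * \sum_(i < m.+1) N i x + h m * N m.+1 x.
  have -> : \sum_y (adj x y)%:R * w y =
      \sum_(i < m.+1) h i * N i.+1 x + \sum_(i < m.+1) h i.+1 * (up i * N i x).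
    transitivity (\sum_(i < m.+1) h i * \sum_y (adj x y)%:R * N i y).
      under eq_bigr do rewrite wE mulr_sumr; rewrite exchange_big /=.
      apply: eq_bigr => i _; rewrite mulr_sumr; apply: eq_bigr => y _.
      by rewrite mulrCA.
    under eq_bigr do rewrite (adj_nbw _ _ _ _ k_gt0 G_reg) mulrDr.
    rewrite big_split /=; congr (_ + _).
    by rewrite big_ord_recl mulr0 add0r [RHS]big_ord_recr /= h_last mul0r addr0.
  have s1 : \sum_(i < m.+1) h i * N i.+1 x =
      \sum_(i < m) h i * N i.+1 x + h m * N m.+1 x by rewrite big_ord_recr.
  have s2 : \sum_(i < m.+1) h i.+1 * (up i * N i x) =
      h 1%N * (k%:R * N 0%N x) + \sum_(i < m) h i.+2 * ((k%:R - 1) * N i.+1 x).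
    by rewrite big_ord_recl.
  have s3 : w x = h 0%N * N 0%N x + \sum_(i < m) h i.+1 * N i.+1 x.
    by rewrite wE big_ord_recl.
  have s4 : \sum_(i < m.+1) N i x = N 0%N x + \sum_(i < m) N i.+1 x.
    by rewrite big_ord_recl.
  have s5 : delta * \sum_(i < m) N i.+1 x =
      \sum_(i < m) h i * N i.+1 x
      + \sum_(i < m) h i.+2 * ((k%:R - 1) * N i.+1 x)
      - lambda * \sum_(i < m) h i.+1 * N i.+1 x.
    rewrite !mulr_sumr -big_split -sumrB; apply: eq_bigr => i _ /=.
    by rewrite -(eqS i (ltn_ord i)); ring.
  by rewrite s1 s2 s3 s4 [delta * (_ + _)]mulrDr s5 -eq0; ring.
have w_ge0 : 0 <= w x.
  by rewrite wE; apply: sumr_ge0 => i _; rewrite mulr_ge0 ?ler0n // h_ge0 // -ltnS.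
rewrite Aw mulrDr ler_wpDr //.
  by rewrite mulr_ge0 // mulr_ge0 ?h_ge0 ?ler0n.
rewrite mulrCA ler_wpM2l // wE mulr_suml; apply: ler_sum => i _.
have [N0|N_gt0] := posnP (nbw (@adj G) u i x).
  by rewrite N0 mulr0 mul0r.
apply: ler_peMr; first by rewrite mulr_ge0 ?ler0n // h_ge0 // -ltnS.
rewrite (bigD1 i) //= ler_wpDr ?ler1n //.
by apply: sumr_ge0 => j _; rewrite ler0n.
Qed.

(** The vector [w] is tested in the variational inequality for the adjacency matrix
after subtraction of its mean; the mean contributes the term in [W ^+ 2 / v]. *)
Lemma order_le_M (R : realType) (k m : nat) (b : R) (G : sgraph) :
  (2 <= k)%N -> 0 < b ->
  admissible k (second_eigenvalue (T k m.+2 b)) G ->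
  (order_of G)%:R <= M k m.+2 b.
Proof.
move=> k_ge2 b_gt0 [G_conn G_reg le_lambda].
have k_gt0 : (0 < k)%N := ltnW k_ge2.
set lambda := second_eigenvalue (T k m.+2 b) in le_lambda.
have lt_k : lambda < k%:R.
  have [x [x_neq0 x_sum0 xA]] := T_eigenvector k_ge2 m b_gt0.
  exact: second_eigenvalue_T_lt x_neq0 x_sum0 xA.
have [phi [last_lt0 last_min phi_sum0 [row0 rowS]]] :=
  T_decreasing_eigenvector k_ge2 m b_gt0.
rewrite -/lambda in row0 rowS.
set a := phi m.+1 in last_lt0 last_min.
pose h i := phi i - a; pose delta := (k%:R - lambda) * - a.
have [u _] := card_gt0P G_conn.1.
pose w y : R := \sum_(i < m.+1) h i * (nbw (@adj G) u i y)%:R.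
have h_ge0 i : (i <= m)%N -> 0 <= h i by move=> im; rewrite subr_ge0 last_min.
have delta_ge0 : 0 <= delta.
  by rewrite mulr_ge0 ?subr_ge0 ?oppr_ge0 // ltW.
have superharmonic x : delta * w x <= w x * (\sum_y (adj x y)%:R * w y - lambda * w x).
  apply: (@radial_superharmonic R k m G u x h w lambda delta) => //.
  - by rewrite /h subrr.
  - by rewrite /h /delta mulrBr row0; ring.
  by move=> i im; rewrite /h /delta [lambda * _]mulrBr -rowS //; ring.
have sum_w : \sum_x w x = - a * M k m.+2 b.
  have -> : \sum_x w x = \sum_(i < m.+1) mass k m b i * phi i
      - a * \sum_(i < m.+1) mass k m b i.
    rewrite exchange_big mulr_sumr -sumrB; apply: eq_bigr => i _ /=.
    rewrite -mulr_sumr (sum_nbw_sphere _ _ _ (@adj_sym G) G_reg) //.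
    by rewrite /mass -ltnS ltn_ord /h; ring.
  have := phi_sum0; rewrite big_ord_recr /= => /eqP; rewrite addr_eq0 => /eqP ->.
  rewrite -sum_mass [in RHS]big_ord_recr /= -/a; ring.
have M_gt0 : 0 < M k m.+2 b by rewrite -sum_mass mass_sum_gt0.
have v_gt0 : 0 < (order_of G)%:R :> R by rewrite ltr0n G_conn.1.
have gap := regular_gap k_ge2 G_conn G_reg w.
set W := \sum_x w x in sum_w gap; set v := (order_of G)%:R in v_gt0 gap *.
have var_ge0 : 0 <= \sum_x w x ^+ 2 - W ^+ 2 / v.
  have sum1 : \sum_(x : vertex G) (1 : R) = v by rewrite sumr_const.
  have := variance_shift (m := fun _ : vertex G => 1) w (W / v).
  have mul1_sum (F : vertex G -> R) : \sum_x 1 * F x = \sum_x F x.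
    by apply: eq_bigr => x _; rewrite mul1r.
  rewrite /variance sum1 !mul1_sum -/W subrr expr0n mulr0 addr0.
  rewrite gt_eqF // => <- //.
  by apply: sumr_ge0 => x _; rewrite sqr_ge0.
have sum_superharmonic : delta * W <=
    (k%:R - lambda) * \sum_x w x ^+ 2
    - \sum_x w x * (k%:R * w x - \sum_y (adj x y)%:R * w y).
  rewrite !mulr_sumr -sumrB; apply: ler_sum => x _.
  by apply: le_trans (superharmonic x) _; rewrite mulrBr mulrBr; lra.
have gap' : (k%:R - lambda) * (\sum_x w x ^+ 2 - W ^+ 2 / v)
    <= \sum_x w x * (k%:R * w x - \sum_y (adj x y)%:R * w y).
  by apply: le_trans gap; rewrite ler_wpM2r // lerB.
have : (k%:R - lambda) * (- a * W) <= (k%:R - lambda) * (W ^+ 2 / v).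
  have := lerB sum_superharmonic gap'; rewrite /delta; lra.
rewrite ler_pM2l ?subr_gt0 // ler_pdivlMr // sum_w.
rewrite (_ : (- a * M k m.+2 b) ^+ 2 = - a * (- a * M k m.+2 b) * M k m.+2 b); last by ring.
by rewrite ler_pM2l // !mulr_gt0 ?oppr_gt0.
Qed.

(** * Comparing v at two eigenvalues *)

(** The handshake lemma: ordering the vertices by rank splits the darts into two
classes exchanged by reversal. *)
Lemma odd_regular_order (k : nat) (G : sgraph) :
  regular k G -> odd k -> ~~ odd (order_of G).
Proof.
move=> G_reg odd_k; pose e := @adj G.
have sum_deg : (\sum_x \sum_y e x y = order_of G * k)%N.
  by under eq_bigr do rewrite (sum_adj G_reg); rewrite sum_nat_const.
pose L := (\sum_x \sum_y (e x y && (enum_rank x < enum_rank y)))%N.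
have : (\sum_x \sum_y e x y = L + L)%N.
  have LE : L = (\sum_x \sum_y (e y x && (enum_rank y < enum_rank x)))%N.
    by rewrite /L exchange_big.
  rewrite {2}LE /L -big_split; apply: eq_bigr => x _ /=.
  rewrite -big_split; apply: eq_bigr => y _ /=; rewrite /e (adj_sym y x).
  case: ltngtP => [_|_|/val_inj/enum_rank_inj->]; rewrite ?andbT ?andbF ?addn0 //.
  by rewrite adj_irrefl.
rewrite sum_deg => /(congr1 odd); rewrite addnn odd_double oddM odd_k andbT.
by move->.
Qed.

(** Enlarging [x] to [y] keeps [G] admissible, and [G] has the largest order for
both as soon as the bound [B] leaves no room for a larger order; for odd [k] all
orders are even, which doubles the room allowed. *)
Lemma v_eq_of_bound (R : realType) (k : nat) (x y B : R) (G : sgraph) :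
  admissible k x G -> x <= y ->
  (forall G', admissible k y G' -> (order_of G')%:R <= B) ->
  B < (order_of G).+1%:R \/ odd k /\ B < (order_of G).+2%:R ->
  v_eq k y x.
Proof.
move=> admG le_xy boundB B_lt.
have weaken G' : admissible k x G' -> admissible k y G'.
  by case=> conn reg le_x; split=> //; apply: le_trans le_xy.
have order_le G' : admissible k y G' -> (order_of G' <= order_of G)%N.
  move=> admG'; have le_B := boundB _ admG'; case: B_lt => [B_lt|[odd_k B_lt]].
    by rewrite -ltnS -(ltr_nat R); apply: le_lt_trans B_lt.
  have : (order_of G' < (order_of G).+2)%N.
    by rewrite -(ltr_nat R); apply: le_lt_trans B_lt.
  rewrite ltnS leq_eqVlt => /orP[/eqP eq_order|]; last by [].
  have [_ reg _] := admG; have [_ reg' _] := admG'.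
  have := odd_regular_order reg' odd_k.
  by rewrite eq_order /= (odd_regular_order reg odd_k).
exists (order_of G); split; try by exists G => //; apply: weaken.
- exact: order_le.
- by move=> G' /weaken; apply: order_le.
Qed.

Lemma M_extend (R : realType) (k m : nat) (b : R) :
  M k m.+3 b = M k m.+2 1 + k%:R * (k%:R - 1) ^+ m.+1 / b.
Proof. by rewrite /M !subn2 /= big_ord_recr /= divr1 addrA. Qed.

Lemma M_last (R : realType) (k m : nat) (b b' : R) :
  M k m.+2 b' = M k m.+2 b + k%:R * (k%:R - 1) ^+ m * (b'^-1 - b^-1).
Proof. by rewrite /M subn2 /=; ring. Qed.

(** The threshold is c A / (A + l c), the value of [c2] at which the difference
equals [l]. *)
Lemma inverse_gain_lt (R : realFieldType) (A c c2 l : R) :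
  0 < A -> 0 < c -> 0 < c2 -> 0 < l ->
  c - l * c ^+ 2 / (A + l * c) < c2 -> A * (c2^-1 - c^-1) < l.
Proof.
move=> A_gt0 c_gt0 c2_gt0 l_gt0.
have d_gt0 : 0 < A + l * c by rewrite addr_gt0 // mulr_gt0.
rewrite (_ : c - _ = c * A / (A + l * c)); last by field; rewrite gt_eqF.
rewrite ltr_pdivrMr // => lt_c2.
rewrite (_ : A * _ = A * (c - c2) / (c * c2)); last by field; rewrite !gt_eqF.
by rewrite ltr_pdivrMr ?mulr_gt0 //; lra.
Qed.

Unset Implicit Arguments.

Theorem proposition2p9 (R : realType) (k t : nat) (c c1 c2 : R)
    (lambda lambda1 lambda2 : R)
    (k_ge2 : (2 <= k)%N) (t_ge2 : (2 <= t)%N)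
    (c_gt0 : 0 < c) (c1_gt0 : 0 < c1) (c2_gt0 : 0 < c2)
    (def_lambda : lambda = second_eigenvalue (T k t c))
    (def_lambda1 : lambda1 = second_eigenvalue (T k t.+1 c1))
    (def_lambda2 : lambda2 = second_eigenvalue (T k t c2))
    (attained : exists2 G : sgraph,
       admissible k lambda G & (order_of G)%:R = M k t c) :
  (c = 1 ->
     (k%:R * (k%:R - 1) ^+ (t - 1) < c1 -> v_eq k lambda1 lambda) /\
     ((exists2 m : nat, ~~ odd m & M k t c = m%:R) -> odd k ->
       k%:R * (k%:R - 1) ^+ (t - 1) / 2 < c1 -> v_eq k lambda1 lambda)) /\
  (1 < c ->
     (c - c ^+ 2 / (k%:R * (k%:R - 1) ^+ (t - 2) + c) < c2 -> c2 <= c ->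
       v_eq k lambda2 lambda) /\
     ((exists2 m : nat, ~~ odd m & M k t c = m%:R) -> odd k ->
       c - 2 * c ^+ 2 / (k%:R * (k%:R - 1) ^+ (t - 2) + 2 * c) < c2 ->
       c2 <= c -> v_eq k lambda2 lambda)).
Proof.
case: t t_ge2 def_lambda def_lambda1 def_lambda2 attained => [|[|m]] // _.
move=> def_lambda def_lambda1 def_lambda2 [G admG order_G].
rewrite subn1 subn2 /=.
have k_gt1 := valency_gt1 R k_ge2.
have order_le_M1 G' : admissible k lambda1 G' -> (order_of G')%:R <= M k m.+3 c1.
  by rewrite def_lambda1; apply: order_le_M.
have order_le_M2 G' : admissible k lambda2 G' -> (order_of G')%:R <= M k m.+2 c2.
  by rewrite def_lambda2; apply: order_le_M.
split=> [c1E|_].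
  have le_lambda : lambda <= lambda1.
    by rewrite def_lambda def_lambda1 c1E second_eigenvalue_T_extend.
  split=> [c1_gt|_ odd_k c1_gt]; apply: (v_eq_of_bound admG le_lambda order_le_M1).
    left; rewrite M_extend -natr1 order_G c1E ltrD2l.
    by rewrite ltr_pdivrMr // mul1r.
  right; split=> //; rewrite M_extend -[(order_of G).+2]addn2 natrD order_G c1E ltrD2l.
  by rewrite ltr_pdivrMr // [ltRHS]mulrC -ltr_pdivrMr ?ltr0n.
have A_gt0 : 0 < k%:R * (k%:R - 1) ^+ m :> R := sphere_gt0 R k_ge2 m.+1.
split=> [c2_gt le_c2|_ odd_k c2_gt le_c2];
  apply: (v_eq_of_bound admG _ order_le_M2);
  rewrite ?def_lambda ?def_lambda2 ?second_eigenvalue_T_last //.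
  left; rewrite (M_last _ _ c) -natr1 order_G ltrD2l.
  by apply: inverse_gain_lt => //; rewrite !mul1r.
right; split=> //; rewrite (M_last _ _ c) -[(order_of G).+2]addn2 natrD order_G ltrD2l.
exact: inverse_gain_lt.
Qed.
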